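(* The system $$r_1^2({\bf x})=\frac{b_1}{2x_1}-\frac1{4d_1}\Big(\frac{L_{111}}{x_1}+\frac{2L_{112}x_2}{x_1^2}+\frac{2L_{122}}{x_1}-\frac{L_{122}x_1}{x_2^2}\Big)=1,$$ $$r_2^2({\bf x})=\frac{b_2}{2x_2}-\frac1{4d_2}\Big(\frac{L_{222}}{x_2}+\frac{2L_{122}x_1}{x_2^2}+\frac{2L_{112}}{x_2}-\frac{L_{112}x_2}{x_1^2}\Big)=1$$ has exactly $3$ solutions in $(\mathbb C^* )^2$, counted with multiplicity, if and only if $$(2d_1+d_2)\,(d_1+2d_2)\,R(r_1^2,r_2^2)\ne0,$$ where $R(r_1^2,r_2^2)$ is the resultant of the polynomials $x_1^2x_2^2\,r_1^2({\bf x})$ and $x_1^2x_2^2\,r_2^2({\bf x})$, i.e., the determinant of the Sylvester matrix $$\begin{bmatrix} L_{122}&L_{222}'&L_{111}'&L_{112}&0&0\\ 0&L_{122}&L_{222}'&L_{111}'&L_{112}&0\\ 0&0&L_{122}&L_{222}'&L_{111}'&L_{112}\\ 3L_{122}&2L_{222}'&L_{111}'&0&0&0\\ 0&3L_{122}&2L_{222}'&L_{111}'&0&0\\ 0&0&3L_{122}&2L_{222}'&L_{111}'&0 \end{bmatrix},$$ where $L'_{111}=L_{111}+2L_{122}-2b_1d_1$ and $L'_{222}=L_{222}+2L_{112}-2b_2d_2$.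
   Context: Here $b_1,b_2,d_1,d_2,L_{111},L_{112},L_{122},L_{222}$ are parameters with $d_1,d_2\neq0$, and ${\bf x}=(x_1,x_2)$; the superscript $2$ in $r_i^2$ is an index (for $\ell=2$), not a power. The identification of the resultant with the displayed determinant is up to nonzero factors (constants and powers of $d_1,d_2$). *)

(* Defs.v *)
From HB Require Import structures.
From mathcomp Require Import all_boot all_order all_algebra fraction ring.
From mathcomp Require Import mpoly complex reals.

Set Implicit Arguments.
Unset Strict Implicit.
Unset Printing Implicit Defensive.

Import GRing.Theory.
Local Open Scope ring_scope.

Section LocalMultiplicity.
Variables (n : nat) (K : fieldType).

Definition ratfun : fieldType := {fraction {mpoly K[n]}}.

Definition ratpoly (u : {mpoly K[n]}) : ratfun := tofrac u.
Definition ratconst (c : K) : ratfun := ratpoly c%:MP.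
Definition ratvar (i : 'I_n) : ratfun := ratpoly 'X_i.

(* [regular_at p] is the local ring O_p of affine n-space at p, as a subring of
   the field of rational functions.  When no coordinate of p vanishes it is also
   the local ring of the torus (K^* )^n at p. *)
Definition regular_at (p : n.-tuple K) (h : ratfun) : Prop :=
  exists u v : {mpoly K[n]},
    v.@[tnth p] != 0 /\ h = ratpoly u / ratpoly v.

(* The ideal (f, g) of O_p; meaningful when f and g are regular at p. *)
Definition local_ideal (p : n.-tuple K) (f g h : ratfun) : Prop :=
  exists a b : ratfun,
    [/\ regular_at p a, regular_at p b & h = a * f + b * g].

(* dim_K (O_p / (f, g)) = m: the classes of e_0, ..., e_(m-1) form a K-basis of
   the quotient.  The relation holds for no m when the dimension is infinite. *)
Definition multiplicity (p : n.-tuple K) (f g : ratfun) (m : nat) : Prop :=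
  exists e : m.-tuple ratfun,
    [/\ forall i, regular_at p (tnth e i),
        forall h, regular_at p h -> exists c : 'I_m -> K,
          local_ideal p f g (h - \sum_(i < m) ratconst (c i) * tnth e i)
      & forall c : 'I_m -> K,
          local_ideal p f g (\sum_(i < m) ratconst (c i) * tnth e i) ->
          forall i, c i = 0].

End LocalMultiplicity.

Section RicciEigenvalues.
Variable F : fieldType.
Variables (b1 b2 d1 d2 L111 L112 L122 L222 : F).

Definition ricci1 (x1 x2 : F) : F :=
  b1 / (2 * x1) - 1 / (4 * d1) *
    (L111 / x1 + 2 * L112 * x2 / x1 ^+ 2 + 2 * L122 / x1
     - L122 * x1 / x2 ^+ 2).

Definition ricci2 (x1 x2 : F) : F :=
  b2 / (2 * x2) - 1 / (4 * d2) *
    (L222 / x2 + 2 * L122 * x1 / x2 ^+ 2 + 2 * L112 / x2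
     - L112 * x2 / x1 ^+ 2).

Lemma clear_ricci1 (x1 x2 : F) : x1 != 0 -> x2 != 0 ->
  b1 * 2^-1 * (x1 * x2 ^+ 2) - 4^-1 * d1^-1 *
    (L111 * (x1 * x2 ^+ 2) + 2 * L112 * x2 ^+ 3
     + 2 * L122 * (x1 * x2 ^+ 2) - L122 * x1 ^+ 3)
  = x1 ^+ 2 * x2 ^+ 2 * ricci1 x1 x2.
Proof.
move=> x1n0 x2n0; rewrite /ricci1 !invfM mul1r.
move: (2^-1) (4^-1) d1^-1 => h q e.
by field; rewrite x1n0 x2n0.
Qed.

Lemma clear_ricci2 (x1 x2 : F) : x1 != 0 -> x2 != 0 ->
  b2 * 2^-1 * (x1 ^+ 2 * x2) - 4^-1 * d2^-1 *
    (L222 * (x1 ^+ 2 * x2) + 2 * L122 * x1 ^+ 3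
     + 2 * L112 * (x1 ^+ 2 * x2) - L112 * x2 ^+ 3)
  = x1 ^+ 2 * x2 ^+ 2 * ricci2 x1 x2.
Proof.
move=> x1n0 x2n0; rewrite /ricci2 !invfM mul1r.
move: (2^-1) (4^-1) d2^-1 => h q e.
by field; rewrite x1n0 x2n0.
Qed.

End RicciEigenvalues.

Section System.
Variable K : fieldType.
Variables (b1 b2 d1 d2 L111 L112 L122 L222 : K).

Local Notation x1 := (ratvar K (0 : 'I_2)).
Local Notation x2 := (ratvar K (1 : 'I_2)).
Local Notation cst := (ratconst 2).

(* r_1 and r_2 as elements of K(x1, x2). *)
Definition ratricci1 : ratfun 2 K :=
  ricci1 (cst b1) (cst d1) (cst L111) (cst L112) (cst L122) x1 x2.
Definition ratricci2 : ratfun 2 K :=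
  ricci2 (cst b2) (cst d2) (cst L112) (cst L122) (cst L222) x1 x2.

Definition torus_solution (p : 2.-tuple K) : Prop :=
  let p1 := tnth p 0 in let p2 := tnth p 1 in
  [/\ p1 != 0, p2 != 0,
      ricci1 b1 d1 L111 L112 L122 p1 p2 = 1
    & ricci2 b2 d2 L112 L122 L222 p1 p2 = 1].

(* There are finitely many solutions in the torus, and their multiplicities are
   finite and add up to N. *)
Definition has_exactly_solutions (N : nat) : Prop :=
  exists (s : seq (2.-tuple K)) (mu : 2.-tuple K -> nat),
    [/\ uniq s,
        forall p, p \in s <-> torus_solution p,
        forall p, p \in s ->
          multiplicity p (ratricci1 - 1) (ratricci2 - 1) (mu p)
      & (\sum_(p <- s) mu p)%N = N].

Definition cleared1 : {mpoly K[2]} :=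
  (b1 / 2)%:MP * ('X_0 * 'X_1 ^+ 2) - (1 / (4 * d1))%:MP *
    (L111%:MP * ('X_0 * 'X_1 ^+ 2) + (2 * L112)%:MP * 'X_1 ^+ 3
     + (2 * L122)%:MP * ('X_0 * 'X_1 ^+ 2) - L122%:MP * 'X_0 ^+ 3).

Definition cleared2 : {mpoly K[2]} :=
  (b2 / 2)%:MP * ('X_0 ^+ 2 * 'X_1) - (1 / (4 * d2))%:MP *
    (L222%:MP * ('X_0 ^+ 2 * 'X_1) + (2 * L122)%:MP * 'X_0 ^+ 3
     + (2 * L112)%:MP * ('X_0 ^+ 2 * 'X_1) - L112%:MP * 'X_1 ^+ 3).

Lemma ratpolyD (u v : {mpoly K[2]}) : ratpoly (u + v) = ratpoly u + ratpoly v.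
Proof. exact: (rmorphD (@tofrac _)). Qed.

Lemma ratpolyN (u : {mpoly K[2]}) : ratpoly (- u) = - ratpoly u.
Proof. exact: (rmorphN (@tofrac _)). Qed.

Lemma ratpolyM (u v : {mpoly K[2]}) : ratpoly (u * v) = ratpoly u * ratpoly v.
Proof. exact: (rmorphM (@tofrac _)). Qed.

Lemma ratpolyX (u : {mpoly K[2]}) k : ratpoly (u ^+ k) = ratpoly u ^+ k.
Proof. exact: (rmorphXn (@tofrac _)). Qed.

Lemma ratpolyC (c : K) : ratpoly c%:MP = cst c. Proof. by []. Qed.

Lemma ratpolyU (i : 'I_2) : ratpoly 'X_i = ratvar K i. Proof. by []. Qed.

Lemma ratconstM (c d : K) : cst (c * d) = cst c * cst d.
Proof. by rewrite /ratconst mpolyCM ratpolyM. Qed.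

Lemma ratconst_nat k : cst (k%:R : K) = k%:R.
Proof. by rewrite /ratconst !rmorph_nat /ratpoly rmorph_nat. Qed.

Lemma ratconstV (c : K) : cst c^-1 = (cst c)^-1.
Proof.
have [->|c0] := eqVneq c 0.
  by rewrite invr0 (ratconst_nat 0) invr0.
have h : cst c^-1 * cst c = 1.
  by rewrite -ratconstM mulVf // (ratconst_nat 1).
have c'0 : cst c != 0.
  by apply/eqP => e; move: h; rewrite e mulr0 => /esym/eqP; rewrite oner_eq0.
by apply: (mulIf c'0); rewrite h mulVf.
Qed.

Lemma ratvar_neq0 (i : 'I_2) : ratvar K i != 0.
Proof.
by rewrite /ratvar /ratpoly tofrac_eq0 -msize_poly_eq0 msizeX.
Qed.

Lemma cleared1E : ratpoly cleared1 = x1 ^+ 2 * x2 ^+ 2 * ratricci1.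
Proof.
rewrite /cleared1 !(ratpolyD, ratpolyN, ratpolyM, ratpolyX, ratpolyC, ratpolyU).
rewrite !mul1r !invfM !(ratconstM, ratconstV, ratconst_nat).
exact: clear_ricci1 (ratvar_neq0 0) (ratvar_neq0 1).
Qed.

Lemma cleared2E : ratpoly cleared2 = x1 ^+ 2 * x2 ^+ 2 * ratricci2.
Proof.
rewrite /cleared2 !(ratpolyD, ratpolyN, ratpolyM, ratpolyX, ratpolyC, ratpolyU).
rewrite !mul1r !invfM !(ratconstM, ratconstV, ratconst_nat).
exact: clear_ricci2 (ratvar_neq0 0) (ratvar_neq0 1).
Qed.

End System.

Section Resultant.
Variable K : comNzRingType.


Definition coef2 (P : {mpoly K[2]}) (a b : nat) : K :=
  P@_(U_(0%R) *+ a + U_(1%R) *+ b)%MM.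

(* Sylvester matrix of binary forms P, Q of degrees m, n: the first n rows are
   the shifts of the coefficients of P, in decreasing powers of x1, the last m
   rows those of Q.  The degrees are explicit since, unlike for the univariate
   [Sylvester_mx], leading coefficients are allowed to vanish. *)
Definition form_Sylvester_mx (m n : nat) (P Q : {mpoly K[2]}) : 'M[K]_(n + m) :=
  \matrix_(i < n + m, j < n + m)
    match split i with
    | inl k => if (k <= j <= k + m)%N then coef2 P (m - (j - k)) (j - k) else 0
    | inr k => if (k <= j <= k + n)%N then coef2 Q (n - (j - k)) (j - k) else 0
    end.

Definition form_resultant (m n : nat) (P Q : {mpoly K[2]}) : K :=
  \det (form_Sylvester_mx m n P Q).

Variables (b1 b2 d1 d2 L111 L112 L122 L222 : K).

Definition L111' : K := L111 + 2 * L122 - 2 * b1 * d1.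
Definition L222' : K := L222 + 2 * L112 - 2 * b2 * d2.

Definition ricci_Sylvester_mx : 'M[K]_6 :=
  \matrix_(i < 6, j < 6) nth 0 (nth [::]
    [:: [:: L122;     L222';     L111';     L112;  0;     0];
        [:: 0;        L122;      L222';     L111'; L112;  0];
        [:: 0;        0;         L122;      L222'; L111'; L112];
        [:: 3 * L122; 2 * L222'; L111';     0;     0;     0];
        [:: 0;        3 * L122;  2 * L222'; L111'; 0;     0];
        [:: 0;        0;         3 * L122;  2 * L222'; L111'; 0]] i) j.

End Resultant.

(* Main.v *)
(* Write P, Q for the cubic forms 4 d1 x1^2 x2^2 r_1 and 4 d2 x1^2 x2^2 r_2, so
   that the system reads P = 4 d1 x1^2 x2^2, Q = 4 d2 x1^2 x2^2.  With
   t = x1 / x2 it becomes G(t) = 0 and x2 = P(t, 1) / (4 d1 t^2), where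
   G = d2 P - d1 Q has leading coefficient (2 d1 + d2) L122 and constant term
   - (d1 + 2 d2) L112.  Hence the local ring of the system at a solution is that
   of G at t, and the solutions in the torus are the roots t <> 0 of G with
   P(t, 1) <> 0, with the same multiplicities.  There are three of them exactly
   when G has degree 3, does not vanish at 0 and shares no root with P, i.e. when
   P and Q have no common root and (2 d1 + d2) (d1 + 2 d2) <> 0. *)

Require Import Defs.
From HB Require Import structures.
From mathcomp Require Import all_boot all_order all_algebra fraction.
From mathcomp Require Import mpoly complex reals.
From mathcomp Require Import ring.
Import GRing.Theory.
Local Open Scope ring_scope.

Set Implicit Arguments.
Unset Strict Implicit.
Unset Printing Implicit Defensive.

(** * Local rings and multiplicities *)

Lemma mpoly_rmorph_eq (n : nat) (R : comNzRingType) (S : nzRingType)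
    (f g : {rmorphism {mpoly R[n]} -> S}) :
  (forall c, f c%:MP = g c%:MP) -> (forall i, f 'X_i = g 'X_i) -> f =1 g.
Proof.
move=> fgC fgX; elim/mpolyind => [|c m u _ _ IH]; first by rewrite !rmorph0.
rewrite !rmorphD IH -mul_mpolyC !rmorphM fgC mpolyXE_id !rmorph_prod.
by congr (_ * _ + _); apply: eq_bigr => i _; rewrite !rmorphXn fgX.
Qed.

(** Since [v] does not vanish at [t0], it is a unit modulo any power of [X - t0], and [r] is [u]
    times a Bezout inverse of [v]. *)
Lemma division_mod_XsubC_exp (K : fieldType) (t0 : K) m (u v : {poly K}) :
  v.[t0] != 0 -> exists r, ('X - t0%:P) ^+ m %| u - r * v.
Proof.
move=> v0; have /Bezout_eq1_coprimepP[[a b] /= ab1] :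
    coprimep v (('X - t0%:P) ^+ m).
  by apply: coprimep_expr; rewrite coprimep_XsubC.
exists (u * a); have -> : u - u * a * v = u * b * ('X - t0%:P) ^+ m.
  by rewrite -[u in u - _]mulr1 -ab1; ring.
exact: dvdp_mulIr.
Qed.

HB.instance Definition _ (n : nat) (K : fieldType) :=
  GRing.RMorphism.copy (@ratpoly n K) (@tofrac {mpoly K[n]}).
HB.instance Definition _ (n : nat) (K : fieldType) :=
  GRing.RMorphism.copy (@ratconst n K) (@tofrac {mpoly K[n]} \o @mpolyC n K).

Section LocalRing.
Variables (n : nat) (K : fieldType) (p : n.-tuple K).
Implicit Types (u v : {mpoly K[n]}) (h f g : ratfun n K).

Lemma ratpoly_eq0 u : (ratpoly u == 0) = (u == 0).
Proof. exact: tofrac_eq0. Qed.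

Lemma ratpoly_neq0 v : v.@[tnth p] != 0 -> ratpoly v != 0.
Proof. by apply: contraNneq => /eqP; rewrite ratpoly_eq0 => /eqP->; rewrite meval0. Qed.

Lemma regular_at_ratpoly u : regular_at p (ratpoly u).
Proof. by exists u, 1; rewrite meval1 oner_neq0 rmorph1 divr1. Qed.

Lemma regular_at_ratpolyV v : v.@[tnth p] != 0 -> regular_at p (ratpoly v)^-1.
Proof. by move=> v0; exists 1, v; rewrite v0 rmorph1 mul1r. Qed.

Lemma regular_atD h1 h2 : regular_at p h1 -> regular_at p h2 -> regular_at p (h1 + h2).
Proof.
move=> [u1 [v1 [v10 ->]]] [u2 [v2 [v20 ->]]].
exists (u1 * v2 + u2 * v1), (v1 * v2); rewrite mevalM mulf_neq0 //; split=> //.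
by rewrite addf_div ?ratpoly_neq0 // rmorphD !rmorphM.
Qed.

Lemma regular_atM h1 h2 : regular_at p h1 -> regular_at p h2 -> regular_at p (h1 * h2).
Proof.
move=> [u1 [v1 [v10 ->]]] [u2 [v2 [v20 ->]]].
exists (u1 * u2), (v1 * v2); rewrite mevalM mulf_neq0 //; split=> //.
by rewrite mulf_div !rmorphM.
Qed.

Lemma local_idealD f g h1 h2 :
  local_ideal p f g h1 -> local_ideal p f g h2 -> local_ideal p f g (h1 + h2).
Proof.
move=> [a1 [b1 [ra1 rb1 ->]]] [a2 [b2 [ra2 rb2 ->]]].
exists (a1 + a2), (b1 + b2); split; [exact: regular_atD..|].
by rewrite !mulrDl addrACA.
Qed.

Lemma local_idealM f g h k :
  regular_at p k -> local_ideal p f g h -> local_ideal p f g (k * h).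
Proof.
move=> rk [a [b [ra rb ->]]].
exists (k * a), (k * b); split; [exact: regular_atM..|].
by rewrite mulrDr !mulrA.
Qed.

Lemma local_ideal0 f g : local_ideal p f g 0.
Proof.
have r0 : regular_at p 0 by rewrite -(rmorph0 (@ratpoly n K)); exact: regular_at_ratpoly.
by exists 0, 0; split=> //; rewrite !mul0r addr0.
Qed.

Lemma local_idealN f g h : local_ideal p f g h -> local_ideal p f g (- h).
Proof.
rewrite -mulN1r; apply: local_idealM.
by rewrite -(rmorph1 (@ratpoly n K)) -rmorphN; apply: regular_at_ratpoly.
Qed.

Lemma local_idealB f g h1 h2 :
  local_ideal p f g h1 -> local_ideal p f g h2 -> local_ideal p f g (h1 - h2).
Proof. by move=> h1I h2I; apply: local_idealD (local_idealN h2I). Qed.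

Lemma local_ideal_sum f g (I : Type) (s : seq I) (F : I -> ratfun n K) :
  (forall i, local_ideal p f g (F i)) -> local_ideal p f g (\sum_(i <- s) F i).
Proof.
by move=> FI; elim/big_ind: _ => //; [apply: local_ideal0 | apply: local_idealD].
Qed.

Lemma regular_at_const c : regular_at p (ratconst n c).
Proof. exact: regular_at_ratpoly. Qed.

Lemma local_idealP f g : regular_at p f -> regular_at p g ->
  local_ideal p f g f /\ local_ideal p f g g.
Proof.
have r0 := regular_at_const 0; have r1 := regular_at_const 1.
rewrite !(rmorph0, rmorph1) in r0 r1.
by split; [exists 1, 0 | exists 0, 1]; rewrite ?mul1r ?mul0r ?addr0 ?add0r.
Qed.

(** The Steinitz argument in the quotient: expand each [e2] on the family [e1] modulo the ideal. If
    [m1 < m2], the coefficient matrix has a nonzero left kernel vector, which is a forbidden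
    relation among the [e2]. *)
Lemma multiplicity_leq f g m1 m2 :
  multiplicity p f g m1 -> multiplicity p f g m2 -> (m2 <= m1)%N.
Proof.
move=> [e1 [_ span1 _]] [e2 [reg2 _ free2]]; rewrite leqNgt; apply/negP => lt12.
have [c ecI] : exists c : 'I_m2 -> 'I_m1 -> K, forall i, local_ideal p f g
    (tnth e2 i - \sum_(j < m1) ratconst n (c i j) * tnth e1 j).
  exact: (fin_all_exists (fun i => span1 _ (reg2 i))).
pose M : 'M[K]_(m2, m1) := \matrix_(i, j) c i j.
have : kermx M != 0.
  by rewrite -mxrank_eq0 mxrank_ker subn_eq0 -ltnNge (leq_ltn_trans (rank_leq_col _)).
case/rowV0Pn => w /sub_kermxP wM w0; case/eqP: w0; apply/rowP => i; rewrite mxE.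
apply: (free2 (w 0)) => {i}.
have -> : \sum_(i < m2) ratconst n (w 0 i) * tnth e2 i
   = \sum_(i < m2) ratconst n (w 0 i) *
       (tnth e2 i - \sum_(j < m1) ratconst n (c i j) * tnth e1 j).
  under [RHS]eq_bigr do rewrite mulrBr.
  rewrite sumrB -[LHS]subr0; congr (_ - _).
  under eq_bigr do rewrite mulr_sumr.
  rewrite exchange_big big1 //= => j _.
  under eq_bigr do rewrite mulrA -rmorphM.
  rewrite -mulr_suml -rmorph_sum.
  have /rowP/(_ j) := wM; rewrite !mxE; under eq_bigr do rewrite mxE.
  by move->; rewrite rmorph0 mul0r.
by apply: local_ideal_sum => i; apply: local_idealM (ecI i); apply: regular_at_const.
Qed.

Lemma multiplicity_inj f g m1 m2 :
  multiplicity p f g m1 -> multiplicity p f g m2 -> m1 = m2.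
Proof. by move=> h1 h2; apply/eqP; rewrite eqn_leq !(@multiplicity_leq f g). Qed.

End LocalRing.

(* When [O_p / (f, g)] is presented as [K[X] / (X - t0)^m]: the variables map to
   polynomials [y i], and [X] is the image of the regular function
   [tau = tn / td]. *)
Section CurveGerm.
Variables (n : nat) (K : fieldType) (p : n.-tuple K).
Variables (t0 : K) (m : nat) (y : 'I_n -> {poly K}) (tn td : {mpoly K[n]}).
Hypothesis y_at_t0 : forall i, (y i).[t0] = tnth p i.
Hypothesis td_neq0 : td.@[tnth p] != 0.

Local Notation phi := (mmap (@polyC K) y).
Local Notation mu := (('X - t0%:P) ^+ m).
Let tau : ratfun n K := ratpoly tn / ratpoly td.

(** Substitution of [h] for [X]. At [h = tau] it lifts [K[X]] back into the local ring, as a section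
    of [residue] below. *)
Definition at_ratfun (h : ratfun n K) (r : {poly K}) : ratfun n K :=
  (map_poly (@ratconst n K) r).[h].
Local Notation theta := (at_ratfun tau).

Hypothesis phi_tn : phi tn = 'X * phi td.

Lemma at_ratfunD h r s : at_ratfun h (r + s) = at_ratfun h r + at_ratfun h s.
Proof. by rewrite /at_ratfun rmorphD hornerD. Qed.

Lemma at_ratfunB h r s : at_ratfun h (r - s) = at_ratfun h r - at_ratfun h s.
Proof. by rewrite /at_ratfun rmorphB hornerD hornerN. Qed.

Lemma at_ratfunM h r s : at_ratfun h (r * s) = at_ratfun h r * at_ratfun h s.
Proof. by rewrite /at_ratfun rmorphM hornerM. Qed.

Lemma at_ratfunC h c : at_ratfun h c%:P = ratconst n c.
Proof. by rewrite /at_ratfun map_polyC hornerC. Qed.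

Lemma at_ratfunX h : at_ratfun h 'X = h.
Proof. by rewrite /at_ratfun map_polyX hornerX. Qed.

Lemma horner_phi u : (phi u).[t0] = u.@[tnth p].
Proof.
move: u; pose e := horner_eval t0 \o phi.
apply: (@mpoly_rmorph_eq _ _ _ e (meval (tnth p))) => [c|i].
  by rewrite /= mmapC mevalC /horner_eval hornerC.
by rewrite /= mmapX mmap1U mevalXU /horner_eval y_at_t0.
Qed.

Lemma phi_coprime v r : v.@[tnth p] != 0 -> (mu %| r * phi v) = (mu %| r).
Proof.
move=> v0; apply: Gauss_dvdpl.
by rewrite coprimep_sym; apply: coprimep_expr; rewrite coprimep_XsubC /root horner_phi.
Qed.

(** The graph of the map from the local ring to [K[X] / mu] induced by [phi]. The congruence is
    cleared of denominators, so no inverse of [phi v] has to be chosen; [residue_uniq] shows that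
    the class of [r] depends on [h] alone. *)
Definition residue (h : ratfun n K) (r : {poly K}) : Prop :=
  exists u v, [/\ v.@[tnth p] != 0, h = ratpoly u / ratpoly v & mu %| phi u - r * phi v].

Lemma residue_regular h : regular_at p h -> exists r, residue h r.
Proof.
move=> [u [v [v0 ->]]].
have [|r rP] := @division_mod_XsubC_exp _ t0 m (phi u) (phi v).
  by rewrite horner_phi.
by exists r, u, v.
Qed.

Lemma residueD h1 h2 r1 r2 : residue h1 r1 -> residue h2 r2 ->
  residue (h1 + h2) (r1 + r2).
Proof.
move=> [u1 [v1 [v10 -> d1]]] [u2 [v2 [v20 -> d2]]].
exists (u1 * v2 + u2 * v1), (v1 * v2); split.
- by rewrite mevalM mulf_neq0.
- by rewrite addf_div ?(ratpoly_neq0 (p := p)) // rmorphD !rmorphM.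
have -> : phi (u1 * v2 + u2 * v1) - (r1 + r2) * phi (v1 * v2)
   = phi v2 * (phi u1 - r1 * phi v1) + phi v1 * (phi u2 - r2 * phi v2).
  by rewrite rmorphD !rmorphM /=; ring.
by rewrite dvdp_addr dvdp_mull.
Qed.

Lemma residueM h1 h2 r1 r2 : residue h1 r1 -> residue h2 r2 ->
  residue (h1 * h2) (r1 * r2).
Proof.
move=> [u1 [v1 [v10 -> d1]]] [u2 [v2 [v20 -> d2]]].
exists (u1 * u2), (v1 * v2); split.
- by rewrite mevalM mulf_neq0.
- by rewrite mulf_div !rmorphM.
have -> : phi (u1 * u2) - r1 * r2 * phi (v1 * v2)
   = phi u2 * (phi u1 - r1 * phi v1) + r1 * phi v1 * (phi u2 - r2 * phi v2).
  by rewrite !rmorphM /=; ring.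
by rewrite dvdp_addr dvdp_mull.
Qed.

Lemma residue_uniq h r1 r2 : residue h r1 -> residue h r2 -> mu %| r1 - r2.
Proof.
move=> [u1 [v1 [v10 -> d1]]] [u2 [v2 [v20 e d2]]].
have uv : phi u1 * phi v2 = phi u2 * phi v1.
  rewrite -!rmorphM; congr phi; apply/eqP; rewrite -subr_eq0 -ratpoly_eq0.
  move/eqP: e; rewrite eqr_div ?(ratpoly_neq0 (p := p)) // => /eqP e.
  by rewrite rmorphB !rmorphM e subrr.
rewrite -(phi_coprime _ v10) -(phi_coprime _ v20).
have -> : (r1 - r2) * phi v1 * phi v2
   = phi v1 * (phi u2 - r2 * phi v2) - phi v2 * (phi u1 - r1 * phi v1).
  by rewrite !mulrBr [phi v2 * phi u1]mulrC uv; ring.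
by rewrite dvdp_subr dvdp_mull.
Qed.

(* No congruence here: unlike [residue], the numerator and the denominator of
   [theta r] can be chosen to represent [r] exactly. *)
Lemma at_ratfun_frac r : exists u v,
  [/\ v.@[tnth p] != 0, theta r = ratpoly u / ratpoly v & phi u = r * phi v].
Proof.
elim/poly_ind: r => [|r c [u [v [v0 e uv]]]].
  exists 0, 1; rewrite meval1 oner_neq0 !rmorph0 !rmorph1 mul0r mul0r; split=> //.
  by rewrite -polyC0 at_ratfunC rmorph0.
exists (u * tn + c%:MP * (v * td)), (v * td); split.
- by rewrite mevalM mulf_neq0.
- rewrite at_ratfunD at_ratfunM at_ratfunX at_ratfunC e /tau rmorphD !rmorphM /=.
  have aux (F : fieldType) (a b c1 d k : F) : b != 0 -> d != 0 ->
      a / b * (c1 / d) + k = (a * c1 + k * (b * d)) / (b * d).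
    by move=> b0 d0; field; rewrite b0 d0.
  exact: aux (ratpoly_neq0 v0) (ratpoly_neq0 td_neq0).
- by rewrite rmorphD !rmorphM /= mmapC uv phi_tn; ring.
Qed.

Lemma residue_theta r : residue (theta r) r.
Proof.
have [u [v [v0 e uv]]] := at_ratfun_frac r.
by exists u, v; rewrite uv subrr dvdp0.
Qed.

Lemma regular_at_theta r : regular_at p (theta r).
Proof. by have [u [v [v0 e _]]] := at_ratfun_frac r; exists u, v. Qed.

(** The numerator of [theta r] has value [r(t0) v(p)] at [p], which is nonzero, so [theta r] is a
    unit of the local ring. *)
Lemma regular_at_thetaV r : r.[t0] != 0 -> regular_at p (theta r)^-1.
Proof.
move=> r0; have [u [v [v0 e uv]]] := at_ratfun_frac r; exists v, u.
by rewrite e invf_div -horner_phi uv hornerM mulf_neq0 // horner_phi.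
Qed.

Lemma theta_neq0 r : r.[t0] != 0 -> theta r != 0.
Proof.
move=> r0; have [u [v [v0 -> uv]]] := at_ratfun_frac r.
rewrite mulf_neq0 ?invr_eq0 ?(ratpoly_neq0 (p := p)) //.
by rewrite -horner_phi uv hornerM mulf_neq0 // horner_phi.
Qed.

Variables f g : ratfun n K.
Hypotheses (f_residue : residue f 0) (g_residue : residue g 0).
Hypothesis vars_theta : forall i, local_ideal p f g (ratvar K i - theta (y i)).
Hypothesis mu_ideal : local_ideal p f g (theta mu).

Lemma ideal_residue h : local_ideal p f g h -> residue h 0.
Proof.
move=> [a [b [/residue_regular[ra aP] /residue_regular[rb bP] ->]]].
have -> : 0 = ra * 0 + rb * 0 :> {poly K} by rewrite !mulr0 addr0.
by apply: residueD; apply: residueM.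
Qed.

Lemma theta_dvd r : mu %| r -> local_ideal p f g (theta r).
Proof.
case/dvdpP => z ->; rewrite at_ratfunM.
exact: local_idealM (regular_at_theta z) mu_ideal.
Qed.

(** The congruence holds for constants and, by [vars_theta], for the variables, and it is stable
    under sums and products. *)
Lemma ratpoly_theta u : local_ideal p f g (ratpoly u - theta (phi u)).
Proof.
have cM u1 u2 : local_ideal p f g (ratpoly u1 - theta (phi u1)) ->
    local_ideal p f g (ratpoly u2 - theta (phi u2)) ->
    local_ideal p f g (ratpoly (u1 * u2) - theta (phi (u1 * u2))).
  move=> h1 h2; rewrite !rmorphM at_ratfunM.
  have -> (S : comNzRingType) (a b c d : S) :
    a * b - c * d = b * (a - c) + c * (b - d) by ring.
  apply: local_idealD; apply: local_idealM => //; first exact: regular_at_ratpoly.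
  exact: regular_at_theta.
have c1 : local_ideal p f g (ratpoly 1 - theta (phi 1)).
  by rewrite !rmorph1 at_ratfunC rmorph1 subrr; apply: local_ideal0.
elim/mpolyind: u => [|c k u _ _ IH].
  by rewrite !rmorph0 -polyC0 at_ratfunC rmorph0 subrr; apply: local_ideal0.
rewrite !rmorphD at_ratfunD opprD addrACA; apply: local_idealD IH.
rewrite -mul_mpolyC; apply: (cM).
  by rewrite mmapC at_ratfunC subrr; apply: local_ideal0.
pose good w := local_ideal p f g (ratpoly w - theta (phi w)).
rewrite mpolyXE_id; apply: (big_ind good c1 cM) => i _; rewrite /good.
elim: (k i) => [|j IHj]; first by rewrite expr0.
by rewrite exprS; apply: cM IHj; rewrite mmapX mmap1U; apply: vars_theta.
Qed.

Lemma theta_residue h r : residue h r -> local_ideal p f g (h - theta r).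
Proof.
move=> [u [v [v0 -> d]]]; have nz := ratpoly_neq0 v0.
(* Of the three terms in the bracket, the outer two are in the ideal by [ratpoly_theta], the middle
   one because [mu] divides its argument. *)
have -> : ratpoly u / ratpoly v - theta r
    = (ratpoly v)^-1 * ((ratpoly u - theta (phi u)) + theta (phi u - r * phi v)
                        - theta r * (ratpoly v - theta (phi v))).
  have aux (F : fieldType) (a b c a' b' : F) : b != 0 ->
      a / b - c = b^-1 * ((a - a') + (a' - c * b') - c * (b - b')).
    by move=> b0; field.
  by rewrite at_ratfunB at_ratfunM; apply: aux.
apply: local_idealM; first exact: regular_at_ratpolyV.
apply: local_idealB; last first.
  by apply: local_idealM (ratpoly_theta v); apply: regular_at_theta.
by apply: local_idealD (ratpoly_theta u) (theta_dvd d).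
Qed.

Lemma theta_poly (c : 'I_m -> K) :
  \sum_(i < m) ratconst n (c i) * tau ^+ i
  = theta (\poly_(i < m) (if insub i is Some j then c j else 0)).
Proof.
rewrite /at_ratfun poly_def rmorph_sum horner_sum; apply: eq_bigr => i _.
by rewrite valK -mul_polyC rmorphM /= map_polyC map_polyXn hornerM hornerC hornerXn.
Qed.

(** The basis is [1, tau, ..., tau^(m-1)], the lift of the monomial basis of [K[X] / mu]. It spans
    because [h] is congruent to [theta r] for any residue [r], and it is free because elements of
    the ideal have residue 0. *)
Lemma multiplicity_curve_germ : multiplicity p f g m.
Proof.
have mu_size : size mu = m.+1 by rewrite size_exp_XsubC.
have mu0 : mu != 0 by rewrite -size_poly_eq0 mu_size.
exists [tuple tau ^+ i | i < m]; split=> [i|h hreg|c].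
- rewrite tnth_mktuple; have -> : tau ^+ i = theta ('X ^+ i).
    by rewrite /at_ratfun map_polyXn hornerXn.
  exact: regular_at_theta.
- have [r /theta_residue hr] := residue_regular hreg.
  exists (fun i => (r %% mu)`_i).
  have -> : \sum_(i < m) ratconst n (r %% mu)`_i * tnth [tuple tau ^+ i | i < m] i
      = theta (r %% mu).
    under eq_bigr do rewrite tnth_mktuple.
    rewrite theta_poly; congr theta; apply/polyP => i; rewrite coef_poly.
    case: ltnP => [lt_im | le_mi]; first by rewrite insubT.
    by rewrite nth_default // (leq_trans _ le_mi) // -ltnS -mu_size ltn_modp.
  have -> : h - theta (r %% mu) = h - theta r + theta (r - r %% mu).
    by rewrite at_ratfunB addrA subrK.
  apply: local_idealD hr (theta_dvd _).
  by rewrite {1}(divp_eq r mu) addrK dvdp_mulIr.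
- under eq_bigr do rewrite tnth_mktuple.
  (* The combination is [theta q] with [q] of degree less than [m]. Its residues [q] and 0 must
     agree modulo [mu], which has degree [m], so [q = 0]. *)
  rewrite theta_poly => /ideal_residue/(residue_uniq (residue_theta _)).
  rewrite subr0 => d i; set q := \poly_(_ < _) _ in d.
  have q0 : q = 0.
    apply/eqP; apply: contraTT d => q0; apply/negP => /(dvdp_leq q0).
    by rewrite mu_size ltnNge size_poly.
  by have := congr1 (fun s : {poly K} => s`_i) q0; rewrite coef0 coef_poly ltn_ord valK.
Qed.

End CurveGerm.

(** * The resultant *)

Lemma meq_U2 a b c d :
  (U_(0%R : 'I_2) *+ a + U_(1%R : 'I_2) *+ b
    == U_(0%R : 'I_2) *+ c + U_(1%R : 'I_2) *+ d)%MM = (a == c) && (b == d).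
Proof.
apply/eqP/andP => [/mnmP e|[/eqP-> /eqP->]//].
split; apply/eqP.
  by have := e 0; rewrite !mnmDE !mulmnE !mnm1E /= !mul1n !mul0n !addn0.
by have := e 1; rewrite !mnmDE !mulmnE !mnm1E /= !mul1n !mul0n !add0n.
Qed.

Lemma det_block_scalar (K : comNzRingType) n (a b c : K) :
  \det (block_mx a%:M b%:M 0 c%:M : 'M_(n + n)) = a ^+ n * c ^+ n.
Proof. by rewrite det_ublock !det_scalar. Qed.

Section DehomogenizedSystem.
Variable K : fieldType.
Variables (b1 b2 d1 d2 L111 L112 L122 L222 : K).
Hypotheses (two_neq0 : (2 : K) != 0) (d1_neq0 : d1 != 0) (d2_neq0 : d2 != 0).

Local Notation A := L122.
Local Notation B := (L222' b2 d2 L112 L222).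
Local Notation C := (L111' b1 d1 L111 L122).
Local Notation D := L112.
Local Notation clr1 := (cleared1 b1 d1 L111 L112 L122).
Local Notation clr2 := (cleared2 b2 d2 L112 L122 L222).

Lemma four_neq0 : (4 : K) != 0.
Proof. by rewrite (_ : 4 = 2 * 2) ?mulf_neq0 //; ring. Qed.

(* [4 d1 * cleared1] and [4 d2 * cleared2], dehomogenized by [x1 = X, x2 = 1]. *)
Definition dehom1 : {poly K} := A *: 'X^3 - C *: 'X - (2 * D)%:P.
Definition dehom2 : {poly K} := D%:P - B *: 'X^2 - (2 * A) *: 'X^3.
(** The polynomial [G]: it eliminates [x2] from [P(t) = 4 d1 t^2 x2] and [Q(t) = 4 d2 t^2 x2]. *)
Definition ratio_poly : {poly K} := d2 *: dehom1 - d1 *: dehom2.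

Lemma cleared1_form :
  (4 * d1)%:MP * clr1
  = A%:MP * 'X_0 ^+ 3 - C%:MP * ('X_0 * 'X_1 ^+ 2) - (2 * D)%:MP * 'X_1 ^+ 3.
Proof.
rewrite /cleared1 /L111' mulrBr !mulrA -!mpolyCM.
have -> : 4 * d1 * (b1 / 2) = 2 * b1 * d1.
  by field.
have -> : 4 * d1 * (1 / (4 * d1)) = 1 by field; rewrite d1_neq0 four_neq0.
rewrite mpolyC1 !(mpolyCM, mpolyCD, mpolyCN). ring.
Qed.

Lemma cleared2_form :
  (4 * d2)%:MP * clr2
  = D%:MP * 'X_1 ^+ 3 - B%:MP * ('X_0 ^+ 2 * 'X_1) - (2 * A)%:MP * 'X_0 ^+ 3.
Proof.
rewrite /cleared2 /L222' mulrBr !mulrA -!mpolyCM.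
have -> : 4 * d2 * (b2 / 2) = 2 * b2 * d2.
  by field.
have -> : 4 * d2 * (1 / (4 * d2)) = 1 by field; rewrite d2_neq0 four_neq0.
rewrite mpolyC1 !(mpolyCM, mpolyCD, mpolyCN). ring.
Qed.

Lemma coef2_cleared1 a b :
  coef2 clr1 a b = (4 * d1)^-1 *
   (A * ((a == 3) && (b == 0))%:R - C * ((a == 1) && (b == 2))%:R
     - 2 * D * ((a == 0) && (b == 3))%:R).
Proof.
have n0 : 4 * d1 != 0 by rewrite mulf_neq0 ?four_neq0.
apply: (mulfI n0); rewrite mulVKf // /coef2 -mcoeffCM cleared1_form.
have -> : 'X_0 ^+ 3
    = 'X_[U_(0%R : 'I_2) *+ 3 + U_(1%R : 'I_2) *+ 0] :> {mpoly K[2]}.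
  by rewrite mulm0n addm0 mpolyXn.
have -> : 'X_1 ^+ 3
    = 'X_[U_(0%R : 'I_2) *+ 0 + U_(1%R : 'I_2) *+ 3] :> {mpoly K[2]}.
  by rewrite mulm0n add0m mpolyXn.
have -> : 'X_0 * 'X_1 ^+ 2
    = 'X_[U_(0%R : 'I_2) *+ 1 + U_(1%R : 'I_2) *+ 2] :> {mpoly K[2]}.
  by rewrite mpolyXD !mpolyXn.
by rewrite !(mcoeffB, mcoeffCM, mcoeffX) !meq_U2 ![_ == a]eq_sym ![_ == b]eq_sym.
Qed.

Lemma coef2_cleared2 a b :
  coef2 clr2 a b = (4 * d2)^-1 *
   (D * ((a == 0) && (b == 3))%:R - B * ((a == 2) && (b == 1))%:R
     - 2 * A * ((a == 3) && (b == 0))%:R).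
Proof.
have n0 : 4 * d2 != 0 by rewrite mulf_neq0 ?four_neq0.
apply: (mulfI n0); rewrite mulVKf // /coef2 -mcoeffCM cleared2_form.
have -> : 'X_0 ^+ 3
    = 'X_[U_(0%R : 'I_2) *+ 3 + U_(1%R : 'I_2) *+ 0] :> {mpoly K[2]}.
  by rewrite mulm0n addm0 mpolyXn.
have -> : 'X_1 ^+ 3
    = 'X_[U_(0%R : 'I_2) *+ 0 + U_(1%R : 'I_2) *+ 3] :> {mpoly K[2]}.
  by rewrite mulm0n add0m mpolyXn.
have -> : 'X_0 ^+ 2 * 'X_1
    = 'X_[U_(0%R : 'I_2) *+ 2 + U_(1%R : 'I_2) *+ 1] :> {mpoly K[2]}.
  by rewrite mpolyXD !mpolyXn.
by rewrite !(mcoeffB, mcoeffCM, mcoeffX) !meq_U2 ![_ == a]eq_sym ![_ == b]eq_sym.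
Qed.

(** Sylvester rows with the denominator [4 d1] cleared; [A, 0, - C, - 2 D] are the coefficients from
    [x1^3] down to [x2^3]. *)
Definition shifts1 : 'M[K]_(3, 6) := \matrix_(i < 3, j < 6) nth 0 (nth [::]
  [:: [:: A; 0; - C; - (2 * D); 0; 0];
      [:: 0; A; 0; - C; - (2 * D); 0];
      [:: 0; 0; A; 0; - C; - (2 * D)]] i) j.

Definition shifts2 : 'M[K]_(3, 6) := \matrix_(i < 3, j < 6) nth 0 (nth [::]
  [:: [:: - (2 * A); - B; 0; D; 0; 0];
      [:: 0; - (2 * A); - B; 0; D; 0];
      [:: 0; 0; - (2 * A); - B; 0; D]] i) j.

Lemma form_Sylvester_cleared :
  form_Sylvester_mx 3 3 clr1 clr2
  = col_mx ((4 * d1)^-1 *: shifts1) ((4 * d2)^-1 *: shifts2).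
Proof.
apply/matrixP => i j; rewrite !mxE; case: split => k; rewrite !mxE.
  case: k => [[|[|[|k]]]] // hk; case: j => [[|[|[|[|[|[|j]]]]]]] // hj;
    rewrite /= ?coef2_cleared1 /=; ring.
case: k => [[|[|[|k]]]] // hk; case: j => [[|[|[|[|[|[|j]]]]]]] // hj;
  rewrite /= ?coef2_cleared2 /=; ring.
Qed.

(* The rows of the displayed matrix are the shifts of [f = - (P + Q)] and of
   [x1 * f_x1 = - (P + 2 Q)], where [P] and [Q] are the cubic forms
   [4 d1 * cleared1] and [4 d2 * cleared2]. *)
Lemma ricci_Sylvester_shifts :
  ricci_Sylvester_mx b1 b2 d1 d2 L111 L112 L122 L222
  = col_mx (- shifts1 - shifts2) (- shifts1 - 2 *: shifts2) :> 'M_(3 + 3).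
Proof.
apply/matrixP => i j; rewrite !mxE.
case: splitP => k ->; rewrite !mxE.
  case: k => [[|[|[|k]]]] // hk; case: j => [[|[|[|[|[|[|j]]]]]]] // hj /=;
  ring.
case: k => [[|[|[|k]]]] // hk; case: j => [[|[|[|[|[|[|j]]]]]]] // hj /=;
ring.
Qed.

Lemma det_ricci_Sylvester :
  \det (ricci_Sylvester_mx b1 b2 d1 d2 L111 L112 L122 L222)
  = 4 ^+ 6 * d1 ^+ 3 * d2 ^+ 3 * form_resultant 3 3 clr1 clr2.
Proof.
have n1 : 4 * d1 != 0 by rewrite mulf_neq0 ?four_neq0.
have n2 : 4 * d2 != 0 by rewrite mulf_neq0 ?four_neq0.
(* [U] turns the row blocks into those of [- (P + Q)] and [- Q]; [V] then adds the first block to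
   the second, giving [- (P + 2 Q)]. The signs cancel in [\det U], since the two blocks have the
   same size 3. *)
pose U : 'M[K]_(3 + 3) :=
  block_mx (- (4 * d1))%:M (- (4 * d2))%:M 0 (- (4 * d2))%:M.
pose V : 'M[K]_(3 + 3) := block_mx 1%:M 0 1%:M 1%:M.
have -> : ricci_Sylvester_mx b1 b2 d1 d2 L111 L112 L122 L222
       = V *m U *m form_Sylvester_mx 3 3 clr1 clr2.
  rewrite ricci_Sylvester_shifts form_Sylvester_cleared -mulmxA.
  rewrite !mul_block_col !mul1mx !mul0mx !mul_scalar_mx addr0 add0r !scalerA.
  rewrite !mulNr !mulfV // !scaleN1r.
  by rewrite -[- _ - _ - _]addrA -opprD -mulr2n scaler_nat mulNrn.
have dU : \det U = (4 * d2) ^+ 3 * (4 * d1) ^+ 3.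
  by rewrite det_block_scalar; ring.
have dV : \det V = 1 by rewrite det_lblock !det1 mulr1.
by rewrite !det_mulmx dU dV /form_resultant; ring.
Qed.

Lemma resultant_shifts :
  form_resultant 3 3 clr1 clr2 = 0 <-> \det (col_mx shifts1 shifts2 : 'M_(3 + 3)) = 0.
Proof.
have n1 : (4 * d1)^-1 != 0 by rewrite invr_eq0 mulf_neq0 ?four_neq0.
have n2 : (4 * d2)^-1 != 0 by rewrite invr_eq0 mulf_neq0 ?four_neq0.
have -> : form_resultant 3 3 clr1 clr2 = (4 * d1)^-1 ^+ 3 * (4 * d2)^-1 ^+ 3
    * \det (col_mx shifts1 shifts2 : 'M_(3 + 3)).
  rewrite /form_resultant form_Sylvester_cleared.
  have -> : col_mx ((4 * d1)^-1 *: shifts1) ((4 * d2)^-1 *: shifts2) =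
     block_mx (4 * d1)^-1%:M 0%:M 0 (4 * d2)^-1%:M *m col_mx shifts1 shifts2.
    by rewrite mul_block_col mul0mx !mul_scalar_mx scale0r addr0 add0r.
  rewrite det_mulmx; congr (_ * _).
  exact: det_block_scalar.
split=> [e|->]; last by rewrite mulr0.
by apply: (mulfI (mulf_neq0 (expf_neq0 3 n1) (expf_neq0 3 n2))); rewrite e mulr0.
Qed.

(** Pairing with the powers [X^5, ..., 1] turns rows into polynomials. Evaluated at a common root it
    gives a right kernel vector; applied to a left kernel vector it gives a relation between [P] and
    [Q]. *)
Lemma shifts1_powers :
  map_mx polyC shifts1 *m (\col_(j < 6) 'X^(5 - j))
  = \col_(i < 3) ('X^(2 - i) * dehom1).
Proof.
apply/matrixP => i j; rewrite !mxE !big_ord_recl big_ord0 !mxE /dehom1 -!mul_polyC.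
by case: i => [[|[|[|i]]]] // hi /=; rewrite !(polyCN, polyCM, polyC0); ring.
Qed.

Lemma shifts2_powers :
  map_mx polyC shifts2 *m (\col_(j < 6) 'X^(5 - j))
  = \col_(i < 3) ('X^(2 - i) * dehom2).
Proof.
apply/matrixP => i j; rewrite !mxE !big_ord_recl big_ord0 !mxE /dehom2 -!mul_polyC.
by case: i => [[|[|[|i]]]] // hi /=; rewrite !(polyCN, polyCM, polyC0); ring.
Qed.

Lemma resultant0_common_root z :
  root dehom1 z -> root dehom2 z -> form_resultant 3 3 clr1 clr2 = 0.
Proof.
move=> /eqP z1 /eqP z2; apply/resultant_shifts.
pose v : 'cV[K]_6 := \col_j z ^+ (5 - j).
have ev (M : 'M[K]_(3, 6)) (r : {poly K}) : r.[z] = 0 ->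
    map_mx polyC M *m (\col_(j < 6) 'X^(5 - j)) = \col_(i < 3) ('X^(2 - i) * r) ->
    M *m v = 0.
  move=> rz /(congr1 (map_mx (horner_eval z))); rewrite map_mxM /=.
  have -> : map_mx (horner_eval z) (map_mx polyC M) = M.
    by apply/matrixP => i j; rewrite !mxE /horner_eval hornerC.
  have -> : map_mx (horner_eval z) (\col_(j < 6) 'X^(5 - j)) = v.
    by apply/matrixP => i j; rewrite !mxE /horner_eval hornerXn.
  move=> ->; apply/matrixP => i j.
  by rewrite !mxE /horner_eval hornerM rz mulr0.
apply/eqP; rewrite -det_tr; apply/det0P; exists v^T.
  (* The last entry of [v] is [z ^+ 0 = 1], so [v] is nonzero even for [z = 0]. *)
  apply/eqP => /matrixP /(_ 0 (Ordinal (isT : (5 < 6)%N))).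
  by rewrite !mxE expr0 => /eqP; rewrite oner_eq0.
rewrite -trmx_mul mul_col_mx (ev _ _ z1 shifts1_powers) (ev _ _ z2 shifts2_powers).
by rewrite col_mx0 trmx0.
Qed.

(** Both leading coefficients, [A] and [- 2 A], vanish, so the first column is zero: the common root
    is at infinity. *)
Lemma resultant0_L122 : A = 0 -> form_resultant 3 3 clr1 clr2 = 0.
Proof.
move=> A0; apply/resultant_shifts.
rewrite (expand_det_col _ 0) big1 // => i _.
rewrite mxE; case: split => k; rewrite mxE A0;
  by case: k => [[|[|[|k]]]] // hk /=; rewrite ?mulr0 ?oppr0 mul0r.
Qed.

Lemma size_dehom1 : A != 0 -> size dehom1 = 4.
Proof.
move=> A0; rewrite /dehom1 -addrA size_polyDl size_scale ?size_polyXn //.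
apply: leq_ltn_trans (size_polyD _ _) _; rewrite !size_polyN gtn_max.
rewrite (leq_ltn_trans (size_scale_leq _ _)) ?size_polyX //.
by rewrite (leq_ltn_trans (size_polyC_leq1 _)).
Qed.

(** A left kernel vector yields [U P + V Q = 0] with [U], [V] of degree at most 2. If [P] and [Q]
    were coprime, [P] would divide [V]; it has degree 3 because [A] is nonzero, so [V = 0], and then
    [U = 0]. *)
Lemma resultant0_coprime :
  A != 0 -> form_resultant 3 3 clr1 clr2 = 0 -> ~~ coprimep dehom1 dehom2.
Proof.
move=> A0 /resultant_shifts /eqP/det0P[v v0 vS]; apply/negP => cop.
pose comb (w : 'rV[K]_3) : {poly K} := \sum_(i < 3) (w 0 i)%:P * 'X^(2 - i).
have comb_size w : (size (comb w) <= 3)%N.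
  apply: (leq_trans (size_sum _ _ _)); apply/bigmax_leqP => i _.
  by rewrite mul_polyC (leq_trans (size_scale_leq _ _)) // size_polyXn ltnS leq_subr.
have comb0 w : comb w = 0 -> w = 0.
  move=> /polyP e; apply/matrixP => i j; rewrite ord1 mxE.
  have := e (2 - j)%N; rewrite coef0 coef_sum (bigD1 j) //= big1 => [|k kj].
    by rewrite addr0 coefCM coefXn eqxx mulr1.
  rewrite coefCM coefXn; case: eqP => [e2|]; rewrite ?mulr0 //.
  by case/eqP: kj; apply/val_inj; move: e2; case: k => [[|[|[|k]]]] // hk;
    case: j => [[|[|[|j]]]] // hj.
have eq0 : comb (lsubmx v) * dehom1 + comb (rsubmx v) * dehom2 = 0.
  have := congr1 (fun M => map_mx polyC M *m (\col_(j < 6) 'X^(5 - j))) vS.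
  rewrite -{1}(hsubmxK v) mul_row_col map_mxD !map_mxM /= mulmxDl -!mulmxA.
  rewrite shifts1_powers shifts2_powers map_mx0 mul0mx => /matrixP/(_ 0 0).
  rewrite !mxE => <-; rewrite /comb !mulr_suml.
  by congr (_ + _); apply: eq_bigr => i _; rewrite !mxE mulrA.
have r0 : rsubmx v = 0.
  apply: comb0; apply/eqP; apply/negPn/negP => nz.
  have : dehom1 %| comb (rsubmx v).
    rewrite -(Gauss_dvdpl _ cop); apply/dvdpP; exists (- comb (lsubmx v)).
    by rewrite mulNr; apply/eqP; rewrite -addr_eq0 addrC eq0.
  move=> /(dvdp_leq nz); rewrite size_dehom1 // => /leq_trans /(_ (comb_size _)).
  by rewrite ltnn.
have l0 : lsubmx v = 0.
  apply: comb0; apply/eqP; move: eq0.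
  rewrite r0 {2}/comb big1 => [|i _]; last by rewrite mxE mul0r.
  move=> /eqP; rewrite mul0r addr0 mulf_eq0 => /orP[//|/eqP e].
  by have := size_dehom1 A0; rewrite e size_poly0.
by case/eqP: v0; rewrite -(hsubmxK v) l0 r0 row_mx0.
Qed.

(** * Torus solutions and their multiplicities *)

Lemma coef3_ratio_poly : ratio_poly`_3 = (2 * d1 + d2) * A.
Proof.
rewrite /ratio_poly /dehom1 /dehom2.
by rewrite !(coefB, coefZ, coefXn, coefX, coefC) /=; ring.
Qed.

Lemma coef0_ratio_poly : ratio_poly`_0 = - ((d1 + 2 * d2) * D).
Proof.
rewrite /ratio_poly /dehom1 /dehom2.
by rewrite !(coefB, coefZ, coefXn, coefX, coefC) /=; ring.
Qed.

Lemma size_ratio_poly : (size ratio_poly <= 4)%N.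
Proof.
apply/leq_sizeP => j j4; rewrite /ratio_poly /dehom1 /dehom2.
rewrite !(coefB, coefZ, coefXn, coefX, coefC).
by case: j j4 => [|[|[|[|j]]]] //= _; ring.
Qed.

Lemma horner_dehom1 t : dehom1.[t] = A * t ^+ 3 - C * t - 2 * D.
Proof. by rewrite /dehom1 !(hornerD, hornerN, hornerZ, hornerXn, hornerX, hornerC). Qed.

Lemma horner_dehom2 t : dehom2.[t] = D - B * t ^+ 2 - 2 * A * t ^+ 3.
Proof. by rewrite /dehom2 !(hornerD, hornerN, hornerZ, hornerXn, hornerC). Qed.

Lemma horner_ratio_poly t : ratio_poly.[t] = d2 * dehom1.[t] - d1 * dehom2.[t].
Proof. by rewrite /ratio_poly hornerD hornerN !hornerZ. Qed.

Lemma ricci1_ratio t x : t != 0 -> x != 0 ->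
  ricci1 b1 d1 L111 L112 L122 (t * x) x = dehom1.[t] / (4 * d1 * t ^+ 2 * x).
Proof.
move=> t0 x0; rewrite horner_dehom1 /ricci1 /L111'.
by field; rewrite d1_neq0 t0 x0 two_neq0 four_neq0.
Qed.

Lemma ricci2_ratio t x : t != 0 -> x != 0 ->
  ricci2 b2 d2 L112 L122 L222 (t * x) x = dehom2.[t] / (4 * d2 * t ^+ 2 * x).
Proof.
move=> t0 x0; rewrite horner_dehom2 /ricci2 /L222'.
by field; rewrite d2_neq0 t0 x0 two_neq0 four_neq0.
Qed.

Local Notation tsol := (torus_solution b1 b2 d1 d2 L111 L112 L122 L222).
Local Notation ratio p := (tnth p 0 / tnth p 1 : K).

Lemma torus_solutionP (p : 2.-tuple K) : tsol p <->
  [/\ ratio p != 0, tnth p 1 != 0,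
      dehom1.[ratio p] = 4 * d1 * ratio p ^+ 2 * tnth p 1
    & dehom2.[ratio p] = 4 * d2 * ratio p ^+ 2 * tnth p 1].
Proof.
have eq1P (a b : K) : b != 0 -> a / b = 1 <-> a = b.
  by move=> b0; split=> [e|->]; [rewrite -(divfK b0 a) e mul1r | rewrite divff].
have n4 := four_neq0.
have E : tnth p 1 != 0 -> tnth p 0 = ratio p * tnth p 1.
  by move=> p1; rewrite divfK.
split=> [[p0 p1] | [t0 p1 e1 e2]].
  have t0 : ratio p != 0 by rewrite mulf_neq0 ?invr_eq0.
  rewrite (E p1) ricci1_ratio ?ricci2_ratio // -(E p1).
  have nz d : d != 0 -> 4 * d * ratio p ^+ 2 * tnth p 1 != 0.
    by move=> d0; exact: mulf_neq0 (mulf_neq0 (mulf_neq0 n4 d0) (expf_neq0 2 t0)) p1.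
  by move=> /(eq1P _ _ (nz _ d1_neq0)) e1 /(eq1P _ _ (nz _ d2_neq0)) e2.
have p0 : tnth p 0 != 0 by rewrite (E p1) mulf_neq0.
have nz d : d != 0 -> 4 * d * ratio p ^+ 2 * tnth p 1 != 0.
  by move=> d0; exact: mulf_neq0 (mulf_neq0 (mulf_neq0 n4 d0) (expf_neq0 2 t0)) p1.
by split=> //; rewrite (E p1) ?ricci1_ratio ?ricci2_ratio //; apply/eq1P => //; exact: nz.
Qed.

Lemma ratio_root p : tsol p -> root ratio_poly (ratio p).
Proof.
case/torus_solutionP => _ _ e1 e2.
by rewrite /root horner_ratio_poly e1 e2; apply/eqP; ring.
Qed.

(** The equation [P(t) = 4 d1 t^2 x2] determines [x2] from [t], and then [x1 = t x2]. *)
Lemma torus_solution_inj p q : tsol p -> tsol q -> ratio p = ratio q -> p = q.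
Proof.
move=> /torus_solutionP[t0 p1 e1 _] /torus_solutionP[_ q1 e2 _] e.
have n0 : 4 * d1 * ratio p ^+ 2 != 0.
  exact: mulf_neq0 (mulf_neq0 four_neq0 d1_neq0) (expf_neq0 2 t0).
have pq1 : tnth p 1 = tnth q 1 by apply: (mulfI n0); rewrite -e1 e e2.
have pq0 : tnth p 0 = tnth q 0 by rewrite -(divfK p1 (tnth p 0)) e pq1 divfK.
apply: eq_from_tnth => i.
by have /orP[/eqP->|/eqP->] : (i == 0) || (i == 1) by case: i => [[|[|]]].
Qed.

(** Stated for any target ring because it serves twice: in the rational functions with [a = tau],
    and in [K[X]] with [a = 'X]. *)
Lemma cleared1_dehom (S : comNzRingType) (F : {rmorphism {mpoly K[2]} -> S})
    (c : {rmorphism K -> S}) (a : S) :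
  (forall k, F k%:MP = c k) -> F 'X_0 = a * F 'X_1 ->
  c (4 * d1) * F clr1 = F 'X_1 ^+ 3 * (map_poly c dehom1).[a].
Proof.
move=> Fc Fa; rewrite -Fc -rmorphM cleared1_form.
have -> : (map_poly c dehom1).[a] = c A * a ^+ 3 - c C * a - c (2 * D).
  rewrite /dehom1; move: (C) => k; rewrite !raddfB /= !map_polyZ /=.
  rewrite map_polyXn map_polyX map_polyC.
  by rewrite !(hornerD, hornerN, hornerZ, hornerXn, hornerX, hornerC).
rewrite -(Fc A) -(Fc C) -(Fc (2 * D)).
move: (A%:MP) (C%:MP) ((2 * D)%:MP) => kA kC kD.
by rewrite !raddfB /= !rmorphM /= Fa; ring.
Qed.

Lemma cleared2_dehom (S : comNzRingType) (F : {rmorphism {mpoly K[2]} -> S})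
    (c : {rmorphism K -> S}) (a : S) :
  (forall k, F k%:MP = c k) -> F 'X_0 = a * F 'X_1 ->
  c (4 * d2) * F clr2 = F 'X_1 ^+ 3 * (map_poly c dehom2).[a].
Proof.
move=> Fc Fa; rewrite -Fc -rmorphM cleared2_form.
have -> : (map_poly c dehom2).[a] = c D - c B * a ^+ 2 - c (2 * A) * a ^+ 3.
  rewrite /dehom2; move: (B) => k; rewrite !raddfB /= !map_polyZ /= !map_polyXn map_polyC.
  by rewrite !(hornerD, hornerN, hornerZ, hornerXn, hornerC).
rewrite -(Fc D) -(Fc B) -(Fc (2 * A)).
move: (D%:MP) (B%:MP) ((2 * A)%:MP) => kD kB kA.
by rewrite !raddfB /= !rmorphM /= Fa; ring.
Qed.

Local Notation f := (ratricci1 b1 d1 L111 L112 L122 - 1).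
Local Notation g := (ratricci2 b2 d2 L112 L122 L222 - 1).

Section Multiplicity.
Variables (p : 2.-tuple K) (m : nat) (q : {poly K}).
Local Notation t0 := (ratio p).
Local Notation mu := (('X - t0%:P) ^+ m).
Hypothesis p_sol : tsol p.
Hypothesis m_gt0 : (0 < m)%N.
Hypothesis ratio_polyE : ratio_poly = mu * q.
Hypothesis q_t0 : q.[t0] != 0.

Local Notation x := (ratvar K (0 : 'I_2)).
Local Notation s := (ratvar K (1 : 'I_2)).
Local Notation c := (@ratconst 2 K).
Local Notation tau := (ratpoly 'X_0 / ratpoly 'X_1 : ratfun 2 K).
Local Notation theta := (at_ratfun tau).

Let t0_neq0 : t0 != 0. Proof. by case/torus_solutionP: p_sol. Qed.
Let p1_neq0 : tnth p 1 != 0. Proof. by case/torus_solutionP: p_sol. Qed.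

Local Notation den := ((4 * d1) *: 'X^2 : {poly K}).

Let den_t0 : den.[t0] = 4 * d1 * t0 ^+ 2.
Proof. by rewrite hornerZ hornerXn. Qed.

Let den_neq0 : den.[t0] != 0.
Proof.
by rewrite den_t0; exact: mulf_neq0 (mulf_neq0 four_neq0 d1_neq0) (expf_neq0 2 t0_neq0).
Qed.

Let p0_neq0 : tnth p 0 != 0.
Proof. by apply: contraNneq t0_neq0 => ->; rewrite mul0r. Qed.

Let s_neq0 : s != 0. Proof. exact: ratvar_neq0. Qed.

Let x_tau : x = tau * s.
Proof. by rewrite -[s]/(ratpoly 'X_1) divfK. Qed.

Let mon : {mpoly K[2]} := 'X_0 ^+ 2 * 'X_1 ^+ 2.

Let mon_neq0 : mon.@[tnth p] != 0.
Proof.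
by rewrite mevalM !rmorphXn /= !mevalXU mulf_neq0 ?expf_neq0.
Qed.

Let f_frac : f = ratpoly (clr1 - mon) / ratpoly mon.
Proof.
rewrite rmorphB /= cleared1E // rmorphM !rmorphXn /= mulrBl divff.
  by rewrite mulrAC divff ?mul1r // mulf_neq0 ?expf_neq0 ?ratvar_neq0.
by rewrite mulf_neq0 ?expf_neq0 ?ratvar_neq0.
Qed.

Let g_frac : g = ratpoly (clr2 - mon) / ratpoly mon.
Proof.
rewrite rmorphB /= cleared2E // rmorphM !rmorphXn /= mulrBl divff.
  by rewrite mulrAC divff ?mul1r // mulf_neq0 ?expf_neq0 ?ratvar_neq0.
by rewrite mulf_neq0 ?expf_neq0 ?ratvar_neq0.
Qed.

Let ideal_fg : local_ideal p f g f /\ local_ideal p f g g.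
Proof. by apply: local_idealP; [exists (clr1 - mon), mon | exists (clr2 - mon), mon]. Qed.

Let theta_dehom1 : theta dehom1 = c (4 * d1) * tau ^+ 2 * s * (f + 1).
Proof.
have := @cleared1_dehom _ (@ratpoly 2 K) (@ratconst 2 K) tau (fun k => erefl _) x_tau.
rewrite /= cleared1E x_tau subrK -[ratpoly 'X_1]/s => e.
apply: (mulfI (expf_neq0 3 s_neq0)); rewrite -e.
by move: (ratricci1 _ _ _ _ _) (c _) tau s => r k t y; ring.
Qed.

Let theta_dehom2 : theta dehom2 = c (4 * d2) * tau ^+ 2 * s * (g + 1).
Proof.
have := @cleared2_dehom _ (@ratpoly 2 K) (@ratconst 2 K) tau (fun k => erefl _) x_tau.
rewrite /= cleared2E x_tau subrK -[ratpoly 'X_1]/s => e.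
apply: (mulfI (expf_neq0 3 s_neq0)); rewrite -e.
by move: (ratricci2 _ _ _ _ _) (c _) tau s => r k t y; ring.
Qed.

Let td_neq0 : ('X_1 : {mpoly K[2]}).@[tnth p] != 0. Proof. by rewrite mevalXU. Qed.

(** The curve [f = 0] is parametrized by [t] through [x2 = P(t) / (4 d1 t^2)], [x1 = t x2]. With [W]
    the truncation of this [x2] modulo [mu], the germ [y = (X W, W)] presents the quotient as [K[X]
    / mu]. *)
Lemma multiplicity_system : multiplicity p f g m.
Proof.
have [W WP] : exists W, mu %| dehom1 - W * den.
  exact: division_mod_XsubC_exp den_neq0.
(* As [m > 0], the congruence defining [W] can be evaluated at [t0], where the first equation of the
   system gives [P(t0) = den(t0) x2]. *)
have W_t0 : W.[t0] = tnth p 1.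
  have : root (dehom1 - W * den) t0.
    case/dvdpP: WP => z ->; rewrite /root hornerM horner_exp hornerXsubC subrr.
    by rewrite expr0n eqn0Ngt m_gt0 mulr0.
  case/torus_solutionP: p_sol => _ _ e1 _.
  rewrite /root hornerD hornerN hornerM e1 den_t0 subr_eq0 => /eqP e.
  by apply: (mulfI den_neq0); rewrite den_t0 e mulrC.
pose y (i : 'I_2) : {poly K} := if i == 0 then 'X * W else W.
pose phi := mmap (@polyC K) y.
have phi_X0 : phi 'X_0 = 'X * phi 'X_1 by rewrite /phi !mmapX !mmap1U.
have phi_mon : phi mon = 'X ^+ 2 * W ^+ 4.
  by rewrite /phi rmorphM !rmorphXn /= !mmapX !mmap1U /y /=; ring.
have y_t0 i : (y i).[t0] = tnth p i.
  have /orP[/eqP->|/eqP->] : (i == 0) || (i == 1) by case: i => [[|[|]]].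
    by rewrite /y /= hornerM hornerX W_t0 divfK.
  by rewrite /y /= W_t0.
have phi_clr1 : (4 * d1)%:P * phi clr1 = W ^+ 3 * dehom1.
  have := @cleared1_dehom _ phi (@polyC K) 'X (mmapC y (@polyC K)) phi_X0.
  by rewrite -/(comp_poly _ _) comp_polyXr /= /phi mmapX mmap1U.
have phi_clr2 : (4 * d2)%:P * phi clr2 = W ^+ 3 * dehom2.
  have := @cleared2_dehom _ phi (@polyC K) 'X (mmapC y (@polyC K)) phi_X0.
  by rewrite -/(comp_poly _ _) comp_polyXr /= /phi mmapX mmap1U.
have dvdC (k : K) r : k != 0 -> mu %| k%:P * r -> mu %| r.
  by move=> k0; rewrite mul_polyC dvdpZr.
have n1 : 4 * d1 != 0 by rewrite mulf_neq0 ?four_neq0.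
have n2 : 4 * d2 != 0 by rewrite mulf_neq0 ?four_neq0.
have f_residue : residue p t0 m y f 0.
  exists (clr1 - mon), mon; split=> //; rewrite mul0r subr0 rmorphB /= -/phi.
  apply: (dvdC _ _ n1); rewrite mulrBr phi_clr1 phi_mon.
  have -> : W ^+ 3 * dehom1 - (4 * d1)%:P * ('X ^+ 2 * W ^+ 4)
      = W ^+ 3 * (dehom1 - W * den) by rewrite -mul_polyC; ring.
  exact: dvdp_mull.
have g_residue : residue p t0 m y g 0.
  exists (clr2 - mon), mon; split=> //; rewrite mul0r subr0 rmorphB /= -/phi.
  apply: (dvdC _ _ n2); apply: (dvdC _ _ d1_neq0).
  rewrite [_ * (_ - _)]mulrBr phi_clr2 phi_mon.
  (* Up to nonzero constants, the image of the numerator of [g] combines that of [f], divisible by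
     [mu] by choice of [W], with [G], divisible by [mu] by hypothesis. *)
  have -> : d1%:P * (W ^+ 3 * dehom2 - (4 * d2)%:P * ('X ^+ 2 * W ^+ 4))
      = W ^+ 3 * (d2%:P * (dehom1 - W * den) - ratio_poly).
    by rewrite /ratio_poly -!mul_polyC !polyCM; ring.
  by rewrite dvdp_mull // dvdp_subr ?dvdp_mull // ratio_polyE dvdp_mulIl.
have reg_theta r : regular_at p (theta r).
  exact: regular_at_theta td_neq0 phi_X0 r.
have reg_tau : regular_at p tau by rewrite -(at_ratfunX tau).
have [fI gI] := ideal_fg.
have mu_ideal : local_ideal p f g (theta mu).
  have q_neq0 := theta_neq0 y_t0 td_neq0 phi_X0 q_t0.
  (* Since [theta q] is a unit, it suffices to put [theta G] in the ideal; it is a regular multiple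
     of [f - g]. *)
  have -> : theta mu = (theta q)^-1 * theta ratio_poly.
    by rewrite ratio_polyE at_ratfunM [RHS]mulrC mulfK.
  apply: local_idealM; first exact (regular_at_thetaV y_t0 td_neq0 phi_X0 q_t0).
  have -> : theta ratio_poly = c (4 * d1 * d2) * tau ^+ 2 * s * (f - g).
    rewrite /ratio_poly -!mul_polyC at_ratfunB !at_ratfunM !at_ratfunC.
    rewrite theta_dehom1 theta_dehom2 !rmorphM /=.
    move: (ratricci1 _ _ _ _ _) (ratricci2 _ _ _ _ _) => r1 r2.
    by move: (c 4) (c d1) (c d2) tau s => k k1 k2 t z; ring.
  apply: local_idealM (local_idealB fI gI).
  by do ![apply: regular_atM => //]; exact: regular_at_ratpoly.
have s_theta : local_ideal p f g (s - theta W).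
  have den_nz := theta_neq0 y_t0 td_neq0 phi_X0 den_neq0.
  have theta_den : theta den = c (4 * d1) * tau ^+ 2.
    by rewrite -mul_polyC 2!at_ratfunM at_ratfunC at_ratfunX.
  (* This uses [theta P = theta den * s * (f + 1)]: modulo [f], the coordinate [s] is
     [theta P / theta den], which [theta W] approximates modulo [theta mu]. *)
  have -> : s - theta W = (theta den)^-1 * theta (dehom1 - W * den) - s * f.
    rewrite at_ratfunB at_ratfunM theta_dehom1 -theta_den.
    move: (ratricci1 _ _ _ _ _) (theta den) (theta W) s den_nz => r.
    have aux (F : fieldType) (e w z k : F) : e != 0 ->
      z - w = e^-1 * (e * z * (k - 1 + 1) - w * e) - z * (k - 1) by move=> e0; field.
    by move=> e w z; exact: aux.
  apply: local_idealB; apply: local_idealM => //.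
  - exact (regular_at_thetaV y_t0 td_neq0 phi_X0 den_neq0).
  - exact (theta_dvd td_neq0 phi_X0 mu_ideal WP).
  - exact: regular_at_ratpoly.
apply: (@multiplicity_curve_germ _ _ p t0 m y 'X_0 'X_1) => // i.
have /orP[/eqP->|/eqP->] : (i == 0) || (i == 1) by case: i => [[|[|]]].
  by rewrite /y /= at_ratfunM at_ratfunX x_tau -mulrBr; apply: local_idealM.
by rewrite /y /=.
Qed.

End Multiplicity.

End DehomogenizedSystem.

Arguments torus_solutionP {K b1 b2 d1 d2 L111 L112 L122 L222} _ _ _ {p}.

(** * Counting the solutions *)

Lemma sum_count_mem (T : eqType) (s r : seq T) : uniq s ->
  (\sum_(t <- s) count_mem t r = count (mem s) r)%N.
Proof.
move=> us; elim: r => [|z r IH] /=; first by rewrite big1.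
rewrite big_split /= IH; congr (_ + _)%N.
under eq_bigr do rewrite eq_sym.
rewrite -(count_uniq_mem z us) -sum1_count [RHS]big_mkcond.
by apply: eq_bigr => t _ /=; case: eqP.
Qed.

Lemma prod_XsubC_count (K : idomainType) (rs : seq K) t :
  \prod_(z <- rs) ('X - z%:P)
  = ('X - t%:P) ^+ count_mem t rs * \prod_(z <- rs | z != t) ('X - z%:P).
Proof.
rewrite (bigID (pred1 t)) /=; congr (_ * _).
rewrite (eq_bigr (fun=> 'X - t%:P)) => [|z /eqP->] //.
by rewrite big_const_seq iter_mulr_1.
Qed.

Section Count.
Variable K : closedFieldType.
Variables (b1 b2 d1 d2 L111 L112 L122 L222 : K).
Hypotheses (two_neq0 : (2 : K) != 0) (d1_neq0 : d1 != 0) (d2_neq0 : d2 != 0).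

Local Notation P := (dehom1 b1 d1 L111 L112 L122).
Local Notation Q := (dehom2 b2 d2 L112 L122 L222).
Local Notation G := (ratio_poly b1 b2 d1 d2 L111 L112 L122 L222).
Local Notation tsol := (torus_solution b1 b2 d1 d2 L111 L112 L122 L222).
Local Notation f := (ratricci1 b1 d1 L111 L112 L122 - 1).
Local Notation g := (ratricci2 b2 d2 L112 L122 L222 - 1).
Local Notation ratio p := (tnth p 0 / tnth p 1 : K).
Local Notation resultant_r := (form_resultant 3 3 (cleared1 b1 d1 L111 L112 L122)
                                              (cleared2 b2 d2 L112 L122 L222)).
Local Notation three_solutions :=
  (has_exactly_solutions b1 b2 d1 d2 L111 L112 L122 L222 3).

(** The factors of [G] other than [X - t], together with [l], form the cofactor [q], which does not
    vanish at [t]. *)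
Lemma multiplicity_count (p : 2.-tuple K) (l : K) (rs : seq K) :
  G = l *: \prod_(z <- rs) ('X - z%:P) -> l != 0 -> tsol p ->
  multiplicity p f g (count_mem (ratio p) rs).
Proof.
move=> GE l0 psol; have root_p := ratio_root two_neq0 d1_neq0 d2_neq0 psol.
pose q := l *: \prod_(z <- rs | z != ratio p) ('X - z%:P).
apply: (@multiplicity_system _ b1 b2 d1 d2 L111 L112 L122 L222 _ _ _ _ _ q) => //.
- by rewrite -has_count has_pred1 -root_prod_XsubC; move: root_p; rewrite GE rootZ.
- by rewrite GE (prod_XsubC_count rs (ratio p)) /q scalerAr.
- rewrite hornerZ mulf_neq0 // horner_prod prodf_seq_neq0.
  by apply/allP => z _; apply/implyP => zt; rewrite hornerXsubC subr_eq0 eq_sym.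
Qed.

Lemma three_solutions_sufficient :
  (2 * d1 + d2) * (d1 + 2 * d2) * resultant_r != 0 -> three_solutions.
Proof.
rewrite !mulf_eq0 !negb_or => /andP[/andP[s1 s2] r0].
have A0 : L122 != 0 by apply: contraNneq r0 => /resultant0_L122 ->.
have common z : root P z -> root Q z -> False.
  move=> zP zQ; move: r0.
  by rewrite (resultant0_common_root two_neq0 d1_neq0 d2_neq0 zP zQ) eqxx.
(* If [L112 = 0], then [P] and [Q] share the root 0. *)
have D0 : L112 != 0.
  apply/eqP => D0; apply: (common 0); rewrite /root ?horner_dehom1 ?horner_dehom2 D0;
    by apply/eqP; ring.
have G3 : G`_3 != 0 by rewrite coef3_ratio_poly mulf_neq0.
have sG : size G = 4%N.
  by apply/eqP; rewrite eqn_leq size_ratio_poly ltnNge; apply: contra G3 => /leq_sizeP->.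
have G0 : G != 0 by rewrite -size_poly_eq0 sG.
have [rs GE] := closed_field_poly_normal G.
have l0 : lead_coef G != 0 by rewrite lead_coef_eq0.
have srs : size rs = 3%N.
  by apply: succn_inj; rewrite -(size_prod_XsubC rs id) -(size_scale _ l0) -GE.
have rootG z : z \in rs -> root G z.
  by move=> zrs; rewrite GE rootZ // root_prod_XsubC.
have rs_neq0 z : z \in rs -> z != 0.
  move=> /rootG rz; apply/eqP => z0; move: rz.
  rewrite z0 /root horner_coef0 coef0_ratio_poly oppr_eq0.
  by rewrite !mulf_eq0 (negPf s2) (negPf D0).
have rs_PQ z : z \in rs -> d2 * P.[z] = d1 * Q.[z].
  by move=> /rootG; rewrite /root horner_ratio_poly subr_eq0 => /eqP.
have P_neq0 z : z \in rs -> P.[z] != 0.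
  move=> zrs; apply/eqP => Pz; apply: (common z); first by apply/eqP.
  apply/eqP/(mulfI d1_neq0); by rewrite -rs_PQ // Pz !mulr0.
have n4 := four_neq0 two_neq0.
(* The value of [x2] forced by the first equation at ratio [z]; the second equation then follows
   from [G(z) = 0]. *)
pose w z := P.[z] / (4 * d1 * z ^+ 2).
pose pt z := [tuple z * w z; w z].
have den_neq0 z : z \in rs -> 4 * d1 * z ^+ 2 != 0.
  by move=> /rs_neq0 z0; exact: mulf_neq0 (mulf_neq0 n4 d1_neq0) (expf_neq0 2 z0).
have w_neq0 z : z \in rs -> w z != 0.
  by move=> zrs; rewrite mulf_neq0 ?invr_eq0 ?P_neq0 ?den_neq0.
have ratio_pt z : z \in rs -> ratio (pt z) = z.
  by move=> /w_neq0 w0; rewrite !(tnth_nth 0) /= mulfK.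
have pt_sol z : z \in rs -> tsol (pt z).
  move=> zrs; apply/(torus_solutionP two_neq0 d1_neq0 d2_neq0); rewrite ratio_pt //.
  have t1 : tnth (pt z) 1 = w z by rewrite (tnth_nth 0).
  have Pw : P.[z] = 4 * d1 * z ^+ 2 * w z by rewrite mulrC divfK ?den_neq0.
  rewrite t1; split; [exact: rs_neq0 | exact: w_neq0 | exact: Pw |].
  by apply: (mulfI d1_neq0); rewrite -rs_PQ // Pw; ring.
(* [rs] lists the roots of [G] with repetition: one solution is taken per distinct root, and the
   repetitions are its multiplicity, so the total is [size rs = 3]. *)
exists [seq pt z | z <- undup rs], (fun p => count_mem (ratio p) rs); split.
- rewrite map_inj_in_uniq ?undup_uniq // => z1 z2; rewrite !mem_undup => h1 h2 e.
  by rewrite -(ratio_pt _ h1) e ratio_pt.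
- move=> p; split=> [/mapP[z]|psol]; first by rewrite mem_undup => /pt_sol ? ->.
  have rp : ratio p \in rs.
    have := ratio_root two_neq0 d1_neq0 d2_neq0 psol.
    by rewrite GE rootZ // root_prod_XsubC.
  apply/mapP; exists (ratio p); first by rewrite mem_undup.
  apply: (torus_solution_inj two_neq0 d1_neq0 d2_neq0 psol (pt_sol _ rp)).
  by rewrite ratio_pt.
- move=> p /mapP[z]; rewrite mem_undup => zrs ->.
  exact: multiplicity_count GE l0 (pt_sol _ zrs).
- rewrite big_map (eq_big_seq (fun z => count_mem z rs)) => [|z]; last first.
    by rewrite mem_undup => zrs; rewrite ratio_pt.
  rewrite sum_count_mem ?undup_uniq // -srs; apply/eqP; rewrite -all_count.
  by apply/allP => z; rewrite /= mem_undup.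
Qed.

Lemma three_solutions_necessary :
  three_solutions -> (2 * d1 + d2) * (d1 + 2 * d2) * resultant_r != 0.
Proof.
move=> [s [mu [us sP muP sum3]]].
have n4 := four_neq0 two_neq0.
(* If [G = 0], the two equations coincide. Then [P = 0] leaves no solution at all, and otherwise
   every [z] with [z P(z) != 0] is the ratio of a solution, so no finite list can be complete. *)
have G0 : G != 0.
  apply/eqP => G0; have P0 : P != 0.
    apply/eqP => P0; move: sum3; rewrite big1_seq // => p /= /sP.
    case/(torus_solutionP two_neq0 d1_neq0 d2_neq0) => t0 p1 + _.
    rewrite P0 horner0 => /esym/eqP.
    rewrite (negPf (mulf_neq0 (mulf_neq0 (mulf_neq0 n4 d1_neq0) (expf_neq0 2 t0)) p1)).
    by [].
  (* Choose [z] nonzero, with [P(z)] nonzero, and different from the ratios of all listed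
     solutions. *)
  have /closed_nonrootP[z] : 'X * P * \prod_(p <- s) ('X - (ratio p)%:P) != 0.
    by rewrite !mulf_neq0 ?polyX_eq0 // -size_poly_eq0 size_prod_XsubC.
  rewrite !rootM rootX !negb_or => /andP[/andP[z0 zP]]; apply/negP; rewrite negbK.
  pose w := P.[z] / (4 * d1 * z ^+ 2).
  have den0 : 4 * d1 * z ^+ 2 != 0.
    exact: mulf_neq0 (mulf_neq0 n4 d1_neq0) (expf_neq0 2 z0).
  have w0 : w != 0 by rewrite mulf_neq0 ?invr_eq0.
  have Pw : P.[z] = 4 * d1 * z ^+ 2 * w by rewrite mulrC divfK.
  pose p := [tuple z * w; w].
  have rp : ratio p = z by rewrite !(tnth_nth 0) /= mulfK.
  have : tsol p.
    apply/(torus_solutionP two_neq0 d1_neq0 d2_neq0).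
    rewrite rp (_ : tnth p 1 = w); last by rewrite (tnth_nth 0).
    split=> //; apply: (mulfI d1_neq0).
    have := horner_ratio_poly b1 b2 d1 d2 L111 L112 L122 L222 z.
    rewrite G0 horner0 => /esym/eqP; rewrite subr_eq0 => /eqP <-.
    by rewrite Pw; ring.
  move=> /sP ps; rewrite /root horner_prod; apply/eqP.
  by rewrite (big_rem p ps) /= rp hornerXsubC subrr mul0r.
have [rs GE] := closed_field_poly_normal G.
have l0 : lead_coef G != 0 by rewrite lead_coef_eq0.
have srs : (size rs).+1 = size G.
  by rewrite -(size_prod_XsubC rs id) -(size_scale _ l0) -GE.
pose T := [seq ratio p | p <- s].
have uT : uniq T.
  rewrite map_inj_in_uniq // => p q /sP hp /sP hq.
  exact: torus_solution_inj hp hq.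
(* By uniqueness of multiplicities, the total 3 counts the roots of [G] lying in [T]. As [G] has
   degree at most 3, it has exactly three roots, all in [T]. *)
have cT : count (mem T) rs = 3%N.
  rewrite -(sum_count_mem rs uT) big_map -sum3; apply: eq_big_seq => p ps.
  have mult := multiplicity_count GE l0 (iffLR (sP p) ps).
  exact: multiplicity_inj mult (muP p ps).
have srs3 : size rs = 3%N.
  apply/eqP; rewrite eqn_leq -{2}cT count_size andbT -ltnS srs.
  exact: size_ratio_poly.
have rootT z : root G z -> z \in T.
  have /allP allT : all (mem T) rs by rewrite all_count cT srs3.
  by rewrite GE rootZ // root_prod_XsubC => /allT.
have T_sol z : z \in T -> z != 0 /\ P.[z] != 0.
  move=> /mapP[p /sP/(torus_solutionP two_neq0 d1_neq0 d2_neq0)[t0 p1 e _] ->].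
  split=> //; rewrite e.
  exact: mulf_neq0 (mulf_neq0 (mulf_neq0 n4 d1_neq0) (expf_neq0 2 t0)) p1.
have : G`_3 != 0 by rewrite -[3%N]/(4.-1) -srs3 srs -lead_coefE.
rewrite coef3_ratio_poly mulf_eq0 negb_or => /andP[s1 A0].
(* A zero constant term would make 0 a root of [G], hence the ratio of a torus solution. *)
have : G`_0 != 0.
  by apply/negP; rewrite -horner_coef0 => /rootT/T_sol[]; rewrite eqxx.
rewrite coef0_ratio_poly oppr_eq0 mulf_eq0 negb_or => /andP[s2 _].
rewrite !mulf_neq0 //; apply/eqP => r0.
(* A common root of [P] and [Q] would be a root of [G], hence the ratio of a solution, where [P]
   cannot vanish. *)
have := resultant0_coprime two_neq0 d1_neq0 d2_neq0 A0 r0.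
rewrite /coprimep => /closed_rootP[z]; rewrite root_gcd => /andP[/eqP zP /eqP zQ].
have /rootT/T_sol[_] : root G z by rewrite /root horner_ratio_poly zP zQ !mulr0 subrr.
by rewrite zP eqxx.
Qed.

End Count.

Theorem proposition2p4 (R : realType)
    (b1 b2 d1 d2 L111 L112 L122 L222 : R[i])
    (hd1 : d1 != 0) (hd2 : d2 != 0) :
  let resultant_r :=
    form_resultant 3 3 (cleared1 b1 d1 L111 L112 L122)
                       (cleared2 b2 d2 L112 L122 L222) in
  \det (ricci_Sylvester_mx b1 b2 d1 d2 L111 L112 L122 L222)
    = 4 ^+ 6 * d1 ^+ 3 * d2 ^+ 3 * resultant_r
  /\ (has_exactly_solutions b1 b2 d1 d2 L111 L112 L122 L222 3
      <-> (2 * d1 + d2) * (d1 + 2 * d2) * resultant_r != 0).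
Proof.
have two_neq0 : (2 : R[i]) != 0 by rewrite Num.Theory.pnatr_eq0.
split; first exact: det_ricci_Sylvester.
by split; [apply: three_solutions_necessary | apply: three_solutions_sufficient].
Qed.
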